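(* Let $R$ be a $d\times d$ expansive integer matrix, and let $B\subset\mathbb{Z}^d$ be some finite set of cardinality $N$. Consider the iterated function system $\tau_b(x)=R^{-1}(x+b)$, $b\in B$, $x\in\mathbb{R}^d$, and let $\mu_B$ be its invariant measure. Let $$m_B(x)=\frac{1}{N}\sum_{b\in B}e^{2\pi i b\cdot x},\quad x\in\mathbb{R}^d.$$ Let $Z$ be the set of the zeroes of $m_B$ in $[0,1)^d$. (i) Suppose $Z$ is contained in a set $Z'\subset[0,1)^d$ of finite cardinality $|Z'|$ which does not contain $0$ and which satisfies $$R^T(Z'+\mathbb{Z}^d)\subset Z'+\mathbb{Z}^d.$$ Then there exist at most $|Z'|+1$ mutually orthogonal exponential functions in $L^2(\mu_B)$. In particular, $\mu_B$ is not a spectral measure. The set $Z'$ can be taken to be $$Z':=\{(R^T)^kx \bmod \mathbb{Z}^d \mid k\ge 0,\ x\in[0,1)^d,\ m_B(x)=0\}$$ if this set is finite and does not contain $0$. (ii) Let $\mathcal{O}(Z)$ be the orbit of $Z$ under the map $x\mapsto R^Tx \bmod \mathbb{Z}^d$, i.e. $$\mathcal{O}(Z):=\{(R^T)^nx \bmod \mathbb{Z}^d \mid x\in Z,\ n\in\mathbb{N}\}.$$ Assume that the Euclidean distance from $\mathcal{O}(Z)$ to $\mathbb{Z}^d$ is $\delta>0$. Then there exist at most $\left(\left\lfloor \frac{\sqrt{d}}{\delta}\right\rfloor+1\right)^d$ mutually orthogonal exponential functions in $L^2(\mu_B)$.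
   Context: A $d\times d$ matrix $R$ is expansive if all its eigenvalues $\lambda$ satisfy $|\lambda|>1$. $R^T$ is the transpose of $R$, and $\mathbb{N}=\{0,1,2,\dots\}$. The invariant measure $\mu_B$ of the iterated function system $(\tau_b)_{b\in B}$ is the unique probability measure on $\mathbb{R}^d$ with $\int f\,d\mu_B=\frac1N\sum_{b\in B}\int f\circ\tau_b\,d\mu_B$ for all $f\in C_c(\mathbb{R}^d)$. For $\lambda\in\mathbb{R}^d$, the exponential function $e_\lambda$ is $e_\lambda(x)=e^{2\pi i\lambda\cdot x}$, viewed as an element of $L^2(\mu_B)$. ''At most $K$ mutually orthogonal exponential functions'' means: every set $\Lambda\subset\mathbb{R}^d$ such that $e_\lambda\perp e_{\lambda'}$ in $L^2(\mu_B)$ for all distinct $\lambda,\lambda'\in\Lambda$ has at most $K$ elements. $\mu_B$ is a spectral measure if there is $\Lambda\subset\mathbb{R}^d$ (called a spectrum) such that $\{e_\lambda\mid\lambda\in\Lambda\}$ is an orthonormal basis of $L^2(\mu_B)$. For $y\in\mathbb{R}^d$, $y\bmod\mathbb{Z}^d$ denotes the unique element of $[0,1)^d$ congruent to $y$ modulo $\mathbb{Z}^d$.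
   Formalization: The clause ''in particular, μ_B is not a spectral measure'' is stated for N ≥ 2 only, since for N = 1 (Z empty, Z' empty allowed) μ_B is a Dirac mass and {e_0} is an orthonormal basis, so the clause is false. *)

(* Defs.v *)
From mathcomp Require Import all_boot all_order all_algebra finmap.
From mathcomp Require Import all_classical all_reals all_analysis.
From mathcomp Require Import complex.

Set Implicit Arguments.
Unset Strict Implicit.
Unset Printing Implicit Defensive.
Import Order.TTheory GRing.Theory Num.Theory.
Import numFieldNormedType.Exports.

Local Open Scope classical_set_scope.
Local Open Scope ring_scope.
Local Open Scope complex_scope.

(* The carrier is 'cV[R]_d, our R^d; the library does not put the Borel
   sigma-algebra on matrices. *)
Definition borel (R : realType) (d : nat) :
    measurableType (@open 'cV[R]_d).-sigma :=
  g_sigma_algebraType (@open 'cV[R]_d).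

Definition realmx (R : realType) (m n : nat) (M : 'M[int]_(m, n)) :
  'M[R]_(m, n) := map_mx intr M.

Definition expansive (R : realType) (d : nat) (A : 'M[int]_d) : Prop :=
  forall l : R[i], eigenvalue (map_mx intr A : 'M[R[i]]_d) l -> 1 < `|l|.

Definition ifs_map (R : realType) (d : nat) (A : 'M[int]_d) (b : 'cV[int]_d)
  (x : 'cV[R]_d) : 'cV[R]_d := invmx (realmx R A) *m (x + realmx R b).

Definition invariant_measure (R : realType) (d : nat) (A : 'M[int]_d)
    (B : {fset 'cV[int]_d}) (mu : probability (borel R d) R) : Prop :=
  forall f : 'cV[R]_d -> R,
    continuous f -> compact (closure [set x | f x != 0]) ->
    Rintegral mu setT f =
    #|` B|%:R^-1 * \sum_(b <- B) Rintegral mu setT (f \o ifs_map A b).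

Definition dot (R : realType) (d : nat) (x y : 'cV[R]_d) : R :=
  \sum_i x i 0 * y i 0.

Definition expfun (R : realType) (d : nat) (l x : 'cV[R]_d) : R[i] :=
  cos (2 * pi * dot l x) +i* sin (2 * pi * dot l x).

Definition cintegral (R : realType) (d : nat) (mu : probability (borel R d) R)
    (f : 'cV[R]_d -> R[i]) : R[i] :=
  Rintegral mu setT (fun x => complex.Re (f x))
  +i* Rintegral mu setT (fun x => complex.Im (f x)).

Definition inner (R : realType) (d : nat) (mu : probability (borel R d) R)
    (f g : 'cV[R]_d -> R[i]) : R[i] :=
  cintegral mu (fun x => f x * (g x)^*).

Definition L2norm (R : realType) (d : nat) (mu : probability (borel R d) R)
    (f : 'cV[R]_d -> R[i]) : \bar R :=
  Lnorm mu 2%:E (fun x : borel R d => (Normc.normc (f x))%:E).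

Definition in_L2 (R : realType) (d : nat) (mu : probability (borel R d) R)
    (f : 'cV[R]_d -> R[i]) : Prop :=
  [/\ measurable_fun setT (fun x : borel R d => complex.Re (f x)),
      measurable_fun setT (fun x : borel R d => complex.Im (f x))
    & (L2norm mu f < +oo)%E].

Definition orthogonal_exps (R : realType) (d : nat)
    (mu : probability (borel R d) R) (L : set 'cV[R]_d) : Prop :=
  forall l l', L l -> L l' -> l <> l' -> inner mu (expfun l) (expfun l') = 0.

Definition at_most_orthogonal_exps (R : realType) (d : nat)
    (mu : probability (borel R d) R) (K : nat) : Prop :=
  forall L : set 'cV[R]_d, orthogonal_exps mu L -> (L #<= `I_K)%card.

(* Orthonormal basis: an orthonormal family whose linear span is dense. *)
Definition is_spectrum (R : realType) (d : nat)
    (mu : probability (borel R d) R) (L : set 'cV[R]_d) : Prop :=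
  [/\ forall l, L l -> inner mu (expfun l) (expfun l) = 1,
      orthogonal_exps mu L
    & forall f, in_L2 mu f -> forall eps : R, 0 < eps ->
        exists (s : seq 'cV[R]_d) (c : 'cV[R]_d -> R[i]),
          (forall l, l \in s -> L l) /\
          (L2norm mu (fun x => f x - \sum_(l <- s) c l * expfun l x)%R
             < eps%:E)%E].

Definition spectral_measure (R : realType) (d : nat)
    (mu : probability (borel R d) R) : Prop :=
  exists L : set 'cV[R]_d, is_spectrum mu L.

Definition mask_fun (R : realType) (d : nat) (B : {fset 'cV[int]_d})
    (x : 'cV[R]_d) : R[i] :=
  #|` B|%:R^-1 * \sum_(b <- B) expfun (realmx R b) x.

Definition unit_cube (R : realType) (d : nat) : set 'cV[R]_d :=
  [set x | forall i, 0 <= x i 0 < 1].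

Definition Zlattice (R : realType) (d : nat) : set 'cV[R]_d :=
  range (@realmx R d 1).

Definition modZ (R : realType) (d : nat) (x : 'cV[R]_d) : 'cV[R]_d :=
  \col_i (x i 0 - (Num.floor (x i 0))%:~R).

Definition mask_zeros (R : realType) (d : nat) (B : {fset 'cV[int]_d}) :
    set 'cV[R]_d :=
  [set x | unit_cube x /\ mask_fun B x = 0].

Definition orbit_zeros (R : realType) (d : nat) (A : 'M[int]_d)
    (B : {fset 'cV[int]_d}) : set 'cV[R]_d :=
  [set y | exists (k : nat) (x : 'cV[R]_d),
     mask_zeros B x /\ y = modZ (((realmx R A)^T ^+ k) *m x)].

Definition periodize (R : realType) (d : nat) (S : set 'cV[R]_d) :
    set 'cV[R]_d :=
  [set x + z | x in S & z in @Zlattice R d].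

Definition admissible (R : realType) (d : nat) (A : 'M[int]_d)
    (B : {fset 'cV[int]_d}) (Z' : set 'cV[R]_d) : Prop :=
  [/\ finite_set Z', Z' `<=` @unit_cube R d, mask_zeros B `<=` Z', ~ Z' 0
    & [set (realmx R A)^T *m x | x in periodize Z'] `<=` periodize Z'].

(* The norm that the library puts on 'cV[R]_d is the sup norm. *)
Definition euclidean_norm (R : realType) (d : nat) (x : 'cV[R]_d) : R :=
  Num.sqrt (dot x x).

(* The distance is +oo when one of the sets is empty. *)
Definition set_dist (R : realType) (d : nat) (S T : set 'cV[R]_d) : \bar R :=
  ereal_inf [set (euclidean_norm (x - y))%:E | x in S & y in T].

(* The division is the one of \bar R, so the quotient is 0 if delta = +oo. *)
Definition packing_bound (R : realType) (d : nat) (delta : \bar R) : nat :=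
  (`|Num.floor (fine ((Num.sqrt d%:R)%:E / delta)%E)|%N + 1) ^ d.

(* Main.v *)
Require Import Defs.
From mathcomp Require Import all_boot all_order all_algebra finmap.
From mathcomp Require Import all_classical all_reals all_analysis.
From mathcomp Require Import complex.
From mathcomp Require Import measurable_realfun ring lra zify.
Import Order.TTheory GRing.Theory Num.Theory.
Import numFieldNormedType.Exports Normc.
(* From here on, realmx is the real matrix of an integer matrix again, and not
   the predicate of matrices with real entries. *)
Import Defs.
Local Open Scope classical_set_scope.
Local Open Scope ring_scope.

Set Implicit Arguments.
Unset Strict Implicit.
Unset Printing Implicit Defensive.

(** Write [S] for the transpose of [A] and [muhat] for the Fourier transform of
    [mu]. Two exponentials are orthogonal exactly when [muhat] vanishes at the
    difference of their frequencies, so everything rests on the zeros of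
    [muhat]. Applied to an exponential, the invariance of [mu] becomes
    [muhat (S y) = m_B y * muhat y] ([fourier_ifs]). If [x] is a zero of
    [muhat], then following the backward orbit [S^-n x] one either meets a zero
    of [m_B] or meets only zeros of [muhat]. In the second case, since [A] is
    expansive, the orbit tends to [0] ([expansive_backward_orbit_cvg0]), where
    [muhat] tends to [1], which is absurd. Hence every zero of [muhat] is
    [S^k y] for a zero [y] of [m_B] ([fourier_eq0]), and the differences of the
    frequencies of an orthogonal family lie, modulo [Z^d], in the orbit of the
    zeros of [m_B] ([orthogonal_modZ_orbit]).

    Both bounds follow by counting. In (i), the differences with one fixed
    frequency reduce modulo [Z^d] to [0] or to a point of [Z'], and two of them
    cannot reduce to the same point since [0] is not in [Z']
    ([card_le_admissible]). In (ii), two frequencies whose fractional parts fall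
    in the same cell of a fine enough cubic grid would have a difference closer
    than [delta] to the lattice, so each cell is used once
    ([card_le_packing]).

    A spectrum would then be a finite set of exponentials with dense span in
    [L^2(mu)]. But the support of [mu] is infinite as soon as [B] has two
    elements ([measure_support_infinite]): each map of the iterated function
    system sends the support into itself, and if the support were finite this
    would force the sum of its points to determine [b]. Small disjoint
    neighbourhoods of enough points of the support carry a nonzero combination
    of bump functions that is orthogonal to any given finite family
    ([exists_orthogonal_function]), which contradicts density
    ([finite_not_spectrum]).

    Measure theory enters only through integrals of bounded continuous
    functions, and the bump functions are the tents [max 0 (1 - |x - c| / r)],
    which also serve as cutoffs to extend the invariance of [mu] from compactly
    supported functions ([invariant_bounded_continuous]). *)

(** * Integration of bounded continuous functions *)

Lemma cvg_sumr (R : realType) (I : Type) (s : seq I) (F : I -> nat -> R) (a :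
  I -> R) :
  (forall i, F i n @[n --> \oo] --> a i) ->
  \sum_(i <- s) F i n @[n --> \oo] --> \sum_(i <- s) a i.
Proof.
move=> Fa; elim: s => [|i s IH].
  by rewrite big_nil; under eq_fun do rewrite big_nil; exact: cvg_cst.
by rewrite big_cons; under eq_fun do rewrite big_cons; exact: cvgD.
Qed.

Section BoundedContinuous.
Context (R : realType) (d : nat) (mu : probability (borel R d) R).
Implicit Types (f g : 'cV[R]_d -> R) (c x y : 'cV[R]_d) (r : R).

Definition bounded_continuous f :=
  continuous f /\ exists M : R, forall x, `|f x| <= M.

Lemma bounded_continuous_cst (k : R) : bounded_continuous (fun=> k).
Proof. by split; [exact: cst_continuous | exists `|k|]. Qed.

Lemma bounded_continuousD f g : bounded_continuous f -> bounded_continuous g ->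
  bounded_continuous (fun x => f x + g x).
Proof.
move=> [cf [M Mf]] [cg [N Ng]]; split; first by move=> x; apply: continuousD;
  [exact: cf|exact: cg].
by exists (M + N) => x; rewrite (le_trans (ler_normD _ _))// lerD.
Qed.

Lemma bounded_continuousM f g : bounded_continuous f -> bounded_continuous g ->
  bounded_continuous (fun x => f x * g x).
Proof.
move=> [cf [M Mf]] [cg [N Ng]]; split; first by move=> x; apply: continuousM;
  [exact: cf|exact: cg].
by exists (M * N) => x; rewrite normrM ler_pM.
Qed.

Lemma bounded_continuous_sum (I : Type) (s : seq I) (F : I -> 'cV[R]_d -> R) :
  (forall i, bounded_continuous (F i)) ->
  bounded_continuous (fun x => \sum_(i <- s) F i x).
Proof.
move=> bF; elim: s => [|i s IH].
  rewrite (_ : (fun x => _) = fun=> 0); first exact: bounded_continuous_cst.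
  by apply/funext => x; rewrite big_nil.
rewrite (_ : (fun x => _) = fun x => F i x + \sum_(j <- s) F j x).
  exact: bounded_continuousD.
by apply/funext => x; rewrite big_cons.
Qed.

(** The preimages of open intervals are open, and the open sets generate the
    sigma-algebra. *)
Lemma measurable_continuous f :
  continuous f -> measurable_fun [set: borel R d] (f : borel R d -> R).
Proof.
move=> cf; apply: (measurability _ (RGenOpens.measurableE R)) => _ [_ [a [b ->]
  <-]].
rewrite setTI; apply: sub_sigma_algebra.
by apply: open_comp; [move=> x _; exact: cf | exact: interval_open].
Qed.

Lemma bounded_continuous_integrable f : bounded_continuous f ->
  mu.-integrable setT (EFin \o f).
Proof.
move=> [cf [M Mf]]; apply: measurable_bounded_integrable => //.
- by rewrite /= (le_lt_trans (probability_le1 _ _))// ltry.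
- exact: measurable_continuous.
- exists M; split; first exact: num_real.
  by move=> N MN x _; apply: le_trans (Mf x) (ltW MN).
Qed.

Lemma Rintegral_sum (I : Type) (s : seq I) (F : I -> 'cV[R]_d -> R) :
  (forall i, bounded_continuous (F i)) ->
  Rintegral mu setT (fun x => \sum_(i <- s) F i x) =
    \sum_(i <- s) Rintegral mu setT (F i).
Proof.
move=> bF; elim: s => [|i s IH].
  rewrite big_nil (_ : (fun x => _) = fun=> 0) ?Rintegral_cst ?mul0r//.
  by apply/funext => x; rewrite big_nil.
rewrite (_ : (fun x => _) = fun x => F i x + \sum_(j <- s) F j x).
  rewrite RintegralD// ?IH ?big_cons//;
    apply: bounded_continuous_integrable => //.
  exact: bounded_continuous_sum.
by apply/funext => x; rewrite big_cons.
Qed.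

Lemma le_Rintegral_bounded_continuous f g : bounded_continuous f ->
  bounded_continuous g ->
  (forall x, f x <= g x) -> Rintegral mu setT f <= Rintegral mu setT g.
Proof.
by move=> bf bg fg; apply: le_Rintegral => //;
  exact: bounded_continuous_integrable.
Qed.

Lemma RintegralZ_bounded_continuous (k : R) f : bounded_continuous f ->
  Rintegral mu setT (fun x => k * f x) = k * Rintegral mu setT f.
Proof. by move=> bf; rewrite RintegralZl//;
  exact: bounded_continuous_integrable. Qed.

Lemma Rintegral_one : Rintegral mu setT (fun=> 1) = 1.
Proof. by rewrite Rintegral_cst// mul1r;
  apply: (congr1 fine (probability_setT mu)). Qed.

Lemma Rintegral_cvg (F : nat -> 'cV[R]_d -> R) f (M : R) :
  (forall n, continuous (F n)) -> (forall n x, `|F n x| <= M) -> continuous f ->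
  (forall x, F ^~ x @ \oo --> f x) ->
  Rintegral mu setT (F n) @[n --> \oo] --> Rintegral mu setT f.
Proof.
move=> cF FM cf Ff.
have bM : mu.-integrable setT (EFin \o (fun=> M)).
  exact/bounded_continuous_integrable/bounded_continuous_cst.
have [||||iF _ h] := @dominated_convergence _ _ _ mu setT measurableT
   (fun n x => (F n x)%:E) (fun x => (f x)%:E) (fun=> M%:E) _ _ _ bM.
- by move=> n; apply/measurable_EFinP; exact: measurable_continuous.
- by apply/measurable_EFinP; exact: measurable_continuous.
- by apply: aeW => /= x _; apply: cvg_EFin; [exact: nearW|exact: Ff].
- by apply: aeW => /= x n _; rewrite lee_fin.
by apply: fine_cvg; rewrite fineK//; exact: integrable_fin_num.
Qed.

End BoundedContinuous.

(** * Tent functions *)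

Section Tent.
Context (R : realType) (d : nat).
Implicit Types (c x y : 'cV[R]_d) (r : R).

Lemma mx_norm_le m n (M : 'M[R]_(m, n)) (k : R) :
  0 <= k -> (forall i j, `|M i j| <= k) -> `|M| <= k.
Proof.
move=> k0 Mk; rewrite [leLHS]/Num.norm/= mx_normrE.
by apply: bigmax_le => // ij _; exact: Mk.
Qed.

Lemma le_mx_norm m n (M : 'M[R]_(m, n)) i j : `|M i j| <= `|M|.
Proof.
rewrite [leRHS]/Num.norm/= mx_normrE.
exact: (le_bigmax _ (fun ij => `|M ij.1 ij.2|) (i, j)).
Qed.

(** In the sup norm, one plus the sum of the absolute values of the entries is
    an operator bound; the extra one keeps it positive. *)
Lemma mulmx_norm_le (P : 'M[R]_d) : exists2 C : R, 0 < C & forall x, `|P *m x|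
  <= C * `|x|.
Proof.
pose C := 1 + \sum_i \sum_j `|P i j|.
have C1 i : \sum_j `|P i j| <= C.
  rewrite /C [X in _ <= 1 + X](bigD1 i)//= addrCA lerDl addr_ge0// sumr_ge0//
    => k _.
  by rewrite sumr_ge0.
have C0 : 0 < C.
  by rewrite /C ltr_pwDl// sumr_ge0// => k _; rewrite sumr_ge0.
exists C => // x; apply: mx_norm_le => [|i j]; first by rewrite mulr_ge0// ltW.
rewrite mxE (le_trans (ler_norm_sum _ _ _))//.
apply: le_trans (_ : \sum_j `|P i j| * `|x| <= _); last first.
  by rewrite -mulr_suml ler_wpM2r.
by apply: ler_sum => k _; rewrite normrM ler_wpM2l// le_mx_norm.
Qed.

Lemma lipschitz_continuous (V W : normedModType R) (f : V -> W) (C : R) :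
  (forall u v, `|f u - f v| <= C * `|u - v|) -> continuous f.
Proof.
move=> fC u; apply/cvgrPdist_lt => e e0.
have C0 : 0 < `|C| + 1 by rewrite ltr_pwDr.
near=> v; apply: le_lt_trans (fC u v) _.
apply: le_lt_trans (_ : (`|C| + 1) * `|u - v| < _).
  by rewrite ler_wpM2r// (le_trans (ler_norm _))// lerDl.
rewrite mulrC -ltr_pdivlMr//; near: v.
by apply: cvgr_dist_lt; rewrite ?divr_gt0.
Unshelve. all: by end_near. Qed.

(** Closed bounded sets of row vectors are compact, and transposition is a
    continuous bijection that preserves the sup norm. *)
Lemma closed_ball_compact r : compact [set x : 'cV[R]_d | `|x| <= r].
Proof.
have tr m n (M : 'M[R]_(m, n)) : `|M^T| <= `|M|.
  by apply: mx_norm_le => // i j; rewrite mxE le_mx_norm.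
have -> : [set x : 'cV[R]_d | `|x| <= r] =
    (fun v : 'rV[R]_d => v^T) @` [set v : 'rV[R]_d | `|v| <= r].
  apply/seteqP; split => [x /= xr|_ [v /= vr <-]];
    last exact: le_trans (tr _ _ _) vr.
  by exists x^T; [exact: le_trans (tr _ _ _) xr|rewrite trmxK].
apply: continuous_compact.
  apply: continuous_subspaceT; apply: (@lipschitz_continuous _ _ _ 1) => x y.
  by rewrite mul1r -linearB; exact: tr.
apply: bounded_closed_compact.
  exists r; split; first exact: num_real.
  by move=> N rN x /= xr; rewrite (le_trans xr)// ltW.
apply: (@preimage_closed _ _ (fun v : 'rV[R]_d => `|v|) [set t | t <= r]) => //.
  by move=> v _; exact: norm_continuous.
Qed.

(** Compactly supported bump functions whose comparisons under Lipschitz maps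
    and changes of radius are pointwise inequalities. *)
Definition tent c r x : R := Num.max 0 (1 - `|x - c| / r).

Lemma tent_ge0 c r x : 0 <= tent c r x.
Proof. by rewrite le_max lexx. Qed.

Lemma tent_le1 c r x : 0 < r -> tent c r x <= 1.
Proof. by move=> r0; rewrite ge_max ler01 gerBl divr_ge0// ltW. Qed.

Lemma tent_eq0 c r x : 0 < r -> r <= `|x - c| -> tent c r x = 0.
Proof. by move=> r0 rx; apply/max_idPl; rewrite subr_le0 ler_pdivlMr ?mul1r.
  Qed.

Lemma tent_ge_half c r x : 0 < r -> `|x - c| < r / 2 -> 1 / 2 <= tent c r x.
Proof.
move=> r0 xr; rewrite le_max; apply/orP; right.
suff : `|x - c| / r <= 1 / 2 by lra.
by rewrite ler_pdivrMr// mulrC mul1r; lra.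
Qed.

(** The tent is at least one half on the ball of half its radius, outside which
    the narrower tent vanishes. This turns positivity of integrals of tents into
    positivity of integrals of their squares. *)
Lemma tent_sqr_ge c r x : 0 < r -> 1 / 4 * tent c (r / 2) x <= tent c r x ^+ 2.
Proof.
move=> r0; have [xr|rx] := ltP `|x - c| (r / 2).
  have := tent_ge_half r0 xr.
  have := @tent_le1 c (r / 2) x; rewrite divr_gt0// => /(_ isT); nra.
by rewrite tent_eq0 ?divr_gt0// mulr0 sqr_ge0.
Qed.

Lemma tent_continuous c r : continuous (tent c r).
Proof.
move=> x; apply: (@continuous_max _ _ (cst 0) (fun x => 1 - `|x - c| / r)).
  exact: cst_continuous.
apply: continuousB; first exact: cst_continuous.
apply: continuousM; last exact: cst_continuous.
apply: (@continuous_comp _ _ _ (fun x => x - c) Num.norm);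
  last exact: norm_continuous.
by apply: continuousB => //; exact: cst_continuous.
Qed.

Lemma tent_bounded_continuous c r : 0 < r -> bounded_continuous (tent c r).
Proof.
move=> r0; split; first exact: tent_continuous.
by exists 1 => x; rewrite ger0_norm ?tent_ge0 ?tent_le1.
Qed.

Lemma tent_compact c r : 0 < r -> compact (closure [set x | tent c r x != 0]).
Proof.
move=> r0; apply: (@subclosed_compact _ _ [set x | `|x| <= `|c| + r]).
- exact: closed_closure.
- exact: closed_ball_compact.
have cl : closed [set x : 'cV[R]_d | `|x| <= `|c| + r].
  apply: (@preimage_closed _ _ (fun x : 'cV[R]_d => `|x|) [set t | t <= `|c|
    + r]).
    by move=> x _; exact: norm_continuous.
  exact: closed_le.
rewrite [X in _ `<=` X](closure_id _).1//; apply: closure_subset => x /= nz.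
have [xr|] := ltP `|x - c| r; last by move/(tent_eq0 r0) => b0;
  rewrite b0 eqxx in nz.
by rewrite -(subrK c x) (le_trans (ler_normD _ _))// addrC lerD2l ltW.
Qed.

Lemma tent_cvg x : tent 0 n.+1%:R x @[n --> \oo] --> (1 : R).
Proof.
apply: (@squeeze_cvgr _ _ _ _ (fun n => 1 - `|x| * n.+1%:R^-1) (fun=> 1)).
- by apply: nearW => n /=; rewrite tent_le1// andbT le_max subr0 lexx orbT.
- rewrite -[X in _ --> X]subr0 -(mulr0 `|x|).
  by apply: cvgB; [exact: cvg_cst|apply: cvgMr; exact: cvg_harmonic].
- exact: cvg_cst.
Qed.

End Tent.

(** * Exponentials and the Fourier transform of a measure *)

Lemma ReD (R : realType) (z w : R[i]) :
  complex.Re (z + w) = complex.Re z + complex.Re w.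
Proof. by case: z; case: w. Qed.

Lemma ImD (R : realType) (z w : R[i]) :
  complex.Im (z + w) = complex.Im z + complex.Im w.
Proof. by case: z; case: w. Qed.

Lemma ReZ (R : realType) (k : R) (z : R[i]) :
  complex.Re (k%:C%C * z) = k * complex.Re z.
Proof. by case: z => a b /=; rewrite mul0r subr0. Qed.

Lemma ImZ (R : realType) (k : R) (z : R[i]) :
  complex.Im (k%:C%C * z) = k * complex.Im z.
Proof. by case: z => a b /=; rewrite mul0r addr0. Qed.

Lemma normc_ge_Re (R : realType) (z : R[i]) : `|complex.Re z| <= Normc.normc z.
Proof.
case: z => a b /=; rewrite -sqrtr_sqr; apply: ler_wsqrtr.
by rewrite lerDl sqr_ge0.
Qed.

Section Fourier.
Context (R : realType) (d : nat) (mu : probability (borel R d) R).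
Implicit Types (l c x y : 'cV[R]_d).


Lemma dotE l x : dot l x = (l^T *m x) 0 0.
Proof. by rewrite mxE; apply: eq_bigr => i _; rewrite mxE. Qed.

Lemma dotC l x : dot l x = dot x l.
Proof. by apply: eq_bigr => i _; rewrite mulrC. Qed.

Lemma dotDl l l' x : dot (l + l') x = dot l x + dot l' x.
Proof. by rewrite !dotE linearD/= mulmxDl mxE. Qed.

Lemma dotNl l x : dot (- l) x = - dot l x.
Proof. by rewrite !dotE linearN/= mulNmx mxE. Qed.

Lemma dot_mulmx (M : 'M[R]_d) l x : dot (M^T *m l) x = dot l (M *m x).
Proof. by rewrite !dotE trmx_mul trmxK mulmxA. Qed.

Lemma dot_norm_le l x : `|dot l x| <= d%:R * `|l| * `|x|.
Proof.
rewrite (le_trans (ler_norm_sum _ _ _))//.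
apply: le_trans (_ : \sum_(i < d) `|l| * `|x| <= _).
  by apply: ler_sum => i _; rewrite normrM ler_pM ?le_mx_norm.
by rewrite sumr_const card_ord -mulrA mulr_natl.
Qed.

Lemma dot_continuous l : continuous (dot l).
Proof.
apply: (@lipschitz_continuous _ _ R^o _ (d%:R * `|l|)) => u v.
by rewrite ![dot l _]dotC -dotNl -dotDl dotC dot_norm_le.
Qed.

Lemma expfunD l l' x : expfun (l + l') x = expfun l x * expfun l' x.
Proof.
by rewrite /expfun dotDl mulrDr cosD sinD; apply/eqP;
  rewrite eq_complex/= addrC !eqxx [X in _ == X]addrC addrC eqxx.
Qed.

Lemma expfunN l x : expfun (- l) x = ((expfun l x)^*)%C.
Proof. by rewrite /expfun dotNl mulrN cosN sinN. Qed.

Lemma expfunC l x : expfun l x = expfun x l.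
Proof. by rewrite /expfun dotC. Qed.

Lemma cintegralZ (k : R[i]) (f : 'cV[R]_d -> R[i]) :
  bounded_continuous (fun x => complex.Re (f x)) ->
  bounded_continuous (fun x => complex.Im (f x)) ->
  cintegral mu (fun x => f x * k) = cintegral mu f * k.
Proof.
move=> /(bounded_continuous_integrable mu) rf /(bounded_continuous_integrable
  mu) jf.
case: k => a b; rewrite /cintegral.
have E1 : (fun x => complex.Re (f x * (a +i* b)%C)) =
   fun x => complex.Re (f x) * a - complex.Im (f x) * b.
  by apply/funext => x; case: (f x).
have E2 : (fun x => complex.Im (f x * (a +i* b)%C)) =
   fun x => complex.Re (f x) * b + complex.Im (f x) * a.
  by apply/funext => x; case: (f x).
have iZ g (c : R) : mu.-integrable setT (EFin \o g) ->
  mu.-integrable setT (EFin \o (fun x => g x * c)).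
  move=> ig; rewrite (_ : _ \o _ = fun x => ((EFin \o g) x * c%:E)%E);
    last first.
    by apply/funext => x.
  exact: integrableZr.
rewrite E1 E2 RintegralB ?RintegralD ?RintegralZr//; try exact: iZ.
Qed.

Definition fourier l : R[i] := cintegral mu (expfun l).

Lemma inner_expfun l l' : inner mu (expfun l) (expfun l') = fourier (l - l').
Proof.
by congr cintegral; apply/funext => x; rewrite expfunD expfunN.
Qed.

Lemma expfun_bounded_continuous l :
  bounded_continuous (fun x => complex.Re (expfun l x)) /\
  bounded_continuous (fun x => complex.Im (expfun l x)).
Proof.
have cd : continuous (fun x => 2 * pi * dot l x).
  move=> x; apply: (@continuousM _ _ (fun=> 2 * pi) (dot l)).
    exact: cst_continuous.
  exact: dot_continuous.
split; split => /=.
- move=> x; apply: (@continuous_comp _ _ _ (fun x => 2 * pi * dot l x) (cos :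
  R -> R)); first exact: cd.
  exact: continuous_cos.
- by exists 1 => x; rewrite ler_norml cos_geN1 cos_le1.
- move=> x; apply: (@continuous_comp _ _ _ (fun x => 2 * pi * dot l x) (sin :
  R -> R)); first exact: cd.
  exact: continuous_sin.
- by exists 1 => x; rewrite ler_norml sin_geN1 sin_le1.
Qed.

(** Dominated convergence: the exponentials of frequencies tending to [0] tend
    pointwise to [1]. *)
Lemma Re_fourier_cvg (u : nat -> 'cV[R]_d) : u @ \oo --> (0 : 'cV[R]_d) ->
  complex.Re (fourier (u n)) @[n --> \oo] --> (1 : R).
Proof.
move=> u0.
rewrite -(Rintegral_one mu).
apply: (@Rintegral_cvg _ _ _ _ _ 1) => //.
- by move=> n; exact: (expfun_bounded_continuous (u n)).1.1.
- by move=> n x /=; rewrite ler_norml cos_geN1 cos_le1.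
- exact: cst_continuous.
move=> x /=; rewrite -[X in _ --> X](cos0 R) -(mulr0 (2 * pi)) -(_ :
  dot x 0 = 0); last first.
  by rewrite dotE mulmx0 mxE.
apply: (@cvg_comp _ _ _ (fun n => 2 * pi * dot (u n) x) (cos : R -> R));
  last exact: continuous_cos.
apply: cvgMr; under eq_fun do rewrite dotC.
exact: (@cvg_comp _ _ _ u (dot x) _ _ _ u0 (@dot_continuous x 0)).
Qed.

End Fourier.

(** * The integer lattice and reduction modulo it *)

Section Periodicity.
Context (R : realType) (d : nat).
Implicit Types (l c x y : 'cV[R]_d).

Lemma trig_2pi_int (m : int) :
  cos (2 * pi * m%:~R) = 1 :> R /\ sin (2 * pi * m%:~R) = 0 :> R.
Proof.
have nat_case (n : nat) : cos (2 * pi * n%:R) = 1 :> R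
  /\ sin (2 * pi * n%:R) = 0 :> R.
  have -> : 2 * pi * n%:R = 0 + (pi *+ 2) *+ n :> R by
    rewrite add0r mulr_natr mulr_natl.
  by rewrite !periodicn ?cos0 ?sin0//; [exact: sinD2pi|exact: cosD2pi].
case: m => n; first exact: nat_case.
by rewrite NegzE mulrNz mulrN cosN sinN; case: (nat_case n.+1) => -> ->;
  rewrite oppr0.
Qed.

Lemma realmxM m n p (M : 'M[int]_(m, n)) (N : 'M[int]_(n, p)) :
  realmx R (M *m N) = realmx R M *m realmx R N.
Proof. exact: map_mxM. Qed.

Lemma expfun_int (b z : 'cV[int]_d) : expfun (realmx R b) (realmx R z) = 1.
Proof.
have [m E] : exists m : int, dot (realmx R b) (realmx R z) = m%:~R.
  by exists ((b^T *m z) 0 0); rewrite dotE /realmx matrix.map_trmx -map_mxM mxE.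
by rewrite /expfun E; have [-> ->] := trig_2pi_int m.
Qed.

Lemma ZlatticeB x y : Zlattice x -> Zlattice y -> Zlattice (x - y).
Proof. by move=> [u _ <-] [v _ <-]; exists (u - v) => //; exact: map_mxB. Qed.

Lemma Zlattice0 : Zlattice (0 : 'cV[R]_d).
Proof. by exists 0 => //; exact: map_mx0. Qed.

Lemma ZlatticeN x : Zlattice x -> Zlattice (- x).
Proof. by rewrite -sub0r; apply: ZlatticeB; exact: Zlattice0. Qed.

Lemma ZlatticeD x y : Zlattice x -> Zlattice y -> Zlattice (x + y).
Proof. by move=> xZ yZ; rewrite -[y]opprK; apply: ZlatticeB => //;
  exact: ZlatticeN. Qed.

Lemma Zlattice_mulmx (M : 'M[int]_d) x : Zlattice x ->
  Zlattice (realmx R M *m x).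
Proof. by move=> [u _ <-]; exists (M *m u) => //; rewrite realmxM. Qed.

Lemma modZ_Zlattice x : Zlattice (x - modZ x).
Proof.
exists (\col_i Num.floor (x i 0)) => //; apply/matrixP => i j.
by rewrite !mxE ord1 opprB addrCA subrr addr0.
Qed.

Lemma modZ_unit_cube x : unit_cube (modZ x).
Proof.
move=> i; rewrite mxE; have /andP[] := floor_itv (x i 0).
by rewrite rmorphD/= => h1 h2; apply/andP; split; lra.
Qed.

(** The coordinates of the difference are integers in the open interval from -1
    to 1. *)
Lemma unit_cube_inj x y : unit_cube x -> unit_cube y -> Zlattice (x - y) ->
  x = y.
Proof.
move=> xc yc [z _ E]; apply/matrixP => i j; rewrite ord1.
have /andP[x0 x1] := xc i; have /andP[y0 y1] := yc i.
have Ei : (z i 0)%:~R = x i 0 - y i 0 :> R.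
  by move/matrixP : E => /(_ i 0); rewrite !mxE.
suff z0 : z i 0 = 0 by move: Ei; rewrite z0 => /esym/eqP;
  rewrite subr_eq0 => /eqP.
have z1 : (z i 0)%:~R < 1%:~R :> R by rewrite Ei; lra.
have z2 : (- 1)%:~R < (z i 0)%:~R :> R by rewrite Ei rmorphN/=; lra.
move: z1 z2; rewrite !ltr_int; lia.
Qed.

Lemma modZ_eq x y : Zlattice (x - y) <-> modZ x = modZ y.
Proof.
split=> [xy|xy].
  apply: unit_cube_inj; [exact: modZ_unit_cube|exact: modZ_unit_cube|].
  rewrite (_ : _ - _ = (x - y) - (x - modZ x) + (y - modZ y)).
    by apply: ZlatticeD (modZ_Zlattice _); apply: ZlatticeB => //;
      exact: modZ_Zlattice.
  by apply/matrixP => i j; rewrite !mxE; ring.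
rewrite (_ : _ - _ = (x - modZ x) - (y - modZ y)); last first.
  by rewrite xy opprB addrA addrNK.
by apply: ZlatticeB; exact: modZ_Zlattice.
Qed.

Lemma modZ_id x : unit_cube x -> modZ x = x.
Proof.
by move=> xc; apply: unit_cube_inj => //;
  [exact: modZ_unit_cube|rewrite -opprB; apply/ZlatticeN/modZ_Zlattice].
Qed.

Lemma unit_cube0 : unit_cube (0 : 'cV[R]_d).
Proof. by move=> i; rewrite mxE lexx ltr01. Qed.

Lemma periodizeP (S : set 'cV[R]_d) x : S `<=` @unit_cube R d ->
  periodize S x <-> S (modZ x).
Proof.
move=> SC; split => [[s Ss [z zZ <-]]|Sx].
  rewrite (_ : modZ _ = s)// -[RHS]modZ_id; last exact: SC.
  by apply/modZ_eq; rewrite addrAC subrr add0r.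
exists (modZ x) => //; exists (x - modZ x); first exact: modZ_Zlattice.
by rewrite addrC subrK.
Qed.

Lemma modZ_mulmx (M : 'M[int]_d) x : modZ (realmx R M *m modZ x) = modZ
  (realmx R M *m x).
Proof.
apply/esym/modZ_eq; rewrite -mulmxBr; apply: Zlattice_mulmx;
  exact: modZ_Zlattice.
Qed.

Lemma mask_fun_modZ (B : {fset 'cV[int]_d}) x :
  mask_fun B (modZ x) = mask_fun B x.
Proof.
congr (_ * _); apply: eq_bigr => b _.
have [z _ E] := modZ_Zlattice x.
have -> : expfun (realmx R b) x = expfun (realmx R b) (realmx R z + modZ x).
  by rewrite E subrK.
by rewrite !(expfunC (realmx R b)) expfunD -(expfunC
  (realmx R b)) expfun_int mul1r.
Qed.

End Periodicity.

(** * Backward orbits of an expansive matrix *)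

Section Expansive.
Context (R : realType).

(** Once [e] is below [eps / 2 * (1 - q)], the excess of [a] over [eps / 2]
    contracts by the factor [q] at each step. *)
Lemma cvg0_affine_recurrence (a e : nat -> R) (q : R) :
  (forall n, 0 <= a n) -> 0 <= q < 1 -> (forall n, a n.+1 <= q * a n + e n) ->
  e @ \oo --> 0 -> a @ \oo --> 0.
Proof.
move=> a0 /andP[q0 q1] ae ecvg; apply/cvgr0Pnorm_lt => eps eps0.
have d0 : 0 < eps / 2 * (1 - q) by rewrite mulr_gt0 ?divr_gt0 ?subr_gt0.
have /cvgr0Pnorm_lt/(_ _ d0)[N _ eN] := ecvg.
have step k : a (N + k)%N <= eps / 2 + q ^+ k * a N.
  elim: k => [|k IH]; first by rewrite addn0 expr0 mul1r lerDr divr_ge0// ltW.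
  rewrite addnS exprS; apply: le_trans (ae _) _.
  have /ltW/(le_trans (ler_norm _)) := eN (N + k)%N (leq_addr _ _).
  have := ler_wpM2l q0 IH; lra.
have : (fun k => q ^+ k * a N) @ \oo --> (0 : R).
  rewrite -(mul0r (a N)); apply: cvgMl; apply: cvg_expr.
  by rewrite ger0_norm.
move/cvgr0Pnorm_lt/(_ (eps / 2)); rewrite divr_gt0// => /(_ isT)[K _ qK].
exists (N + K)%N => // n /= nNK.
have Nn : (N <= n)%N by rewrite (leq_trans _ nNK)// leq_addr.
have kK : (K <= n - N)%N by rewrite leq_subRL.
have := qK _ kK; have := step (n - N)%N;
  rewrite subnKC// ger0_norm ?mulr_ge0 ?exprn_ge0// => h1 h2.
have -> : `|a n| = a n by exact: ger0_norm.
lra.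
Qed.

(** Induction on the factors of the annihilating polynomial. Removing the factor
    of [l] replaces [u] by [w = M u - l u], which tends to [0] by induction;
    since [l u_(k+1) = u_k - w_(k+1)] and [1 < |l|], so does [u]. *)
Lemma orbit_cvg0 (n : nat) (M : 'M[R[i]]_n.+1) (s : seq R[i])
    (u : nat -> 'cV[R[i]]_n.+1) :
  (forall l, l \in s -> 1 < normc l) ->
  (forall k, M *m u k.+1 = u k) ->
  (forall k, horner_mx M (\prod_(l <- s) ('X - l%:P)) *m u k = 0) ->
  forall i, normc (u k i 0) @[k --> \oo] --> (0 : R).
Proof.
elim: s u => [|l s IH] u s1 uM.
  rewrite big_nil rmorph1 => u0 i.
  rewrite (_ : (fun k => _) = fun=> 0); first exact: cvg_cst.
  by apply/funext => k; rewrite -(mul1mx (u k)) u0 mxE normc0.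
rewrite big_cons mulrC rmorphM rmorphB/= horner_mx_X horner_mx_C => pu i.
pose w k := M *m u k - l *: u k.
have w0 : forall i, normc (w k i 0) @[k --> \oo] --> (0 : R).
  apply: IH => [z zs|k|k]; first by rewrite s1// inE zs orbT.
    by rewrite /w mulmxBr -scalemxAr uM.
  by rewrite /w -mul_scalar_mx -mulmxBl mulmxA.
have l1 : 1 < normc l by rewrite s1// mem_head.
have l0 : 0 < normc l by apply: lt_trans l1.
apply: (@cvg0_affine_recurrence _ (fun k => (normc l)^-1 * normc (w k.+1 i 0))
  (normc l)^-1).
- by move=> k; case: (u k i 0) => ? ?; rewrite sqrtr_ge0.
- by rewrite invr_ge0 ltW//= invf_lt1.
- move=> k; have E : l * u k.+1 i 0 = u k i 0 - w k.+1 i 0.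
    by rewrite /w uM !mxE opprB addrCA subrr addr0.
  rewrite -mulrDr mulrC ler_pdivlMr// mulrC -normcM E.
  by rewrite (le_trans (le_normcD _ _))// normcN.
- rewrite -(mulr0 (normc l)^-1); apply: cvgMr.
  move: (w0 i); set e := (fun k => normc (w k i 0)) => e0.
  by rewrite -(cvg_shiftS e) in e0.
Qed.

Lemma char_poly_trmx (F : comNzRingType) n (M : 'M[F]_n) :
  char_poly M^T = char_poly M.
Proof.
rewrite /char_poly -det_tr; congr (\det _); apply/matrixP => i j.
by rewrite !mxE eq_sym.
Qed.

Lemma expansive_unitmx d (A : 'M[int]_d) : expansive R A ->
  realmx R A \in unitmx.
Proof.
move=> hA; rewrite unitmxE unitfE; apply/negP => /det0P[v v0 vA].
suff /hA : eigenvalue (map_mx intr A : 'M[R[i]]_d) 0 by rewrite normr0 ltr10.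
apply/eigenvalueP.
exists (map_mx (real_complex R) v); last by rewrite map_mx_eq0.
rewrite scale0r (_ : map_mx intr A = map_mx (real_complex R) (realmx R A)).
  by rewrite -map_mxM vA map_mx0.
by apply/matrixP => i j; rewrite !mxE rmorph_int.
Qed.

(** By Cayley-Hamilton the characteristic polynomial annihilates the orbit, and
    over the complex numbers it splits into factors of roots of modulus greater
    than one. *)
Lemma expansive_backward_orbit_cvg0 d (A : 'M[int]_d) (u : nat -> 'cV[R]_d) :
  expansive R A -> (forall n, (realmx R A)^T *m u n.+1 = u n) ->
  u @ \oo --> (0 : 'cV[R]_d).
Proof.
case: d A u => [|d] A u hA uA.
  rewrite (_ : u = fun=> 0); first exact: cvg_cst.
  by apply/funext => n; apply/matrixP => -[].
pose M : 'M[R[i]]_d.+1 := (map_mx intr A)^T.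
have [s sM] := closed_field_poly_normal (char_poly M).
have cM : char_poly M = char_poly (map_mx intr A) by exact: char_poly_trmx.
rewrite (monicP (char_poly_monic M)) scale1r in sM.
have coord i : `|u n i 0| @[n --> \oo] --> (0 : R).
  have := @orbit_cvg0 d M s (fun n => map_mx (real_complex R) (u n)) _ _ _ i.
  have -> : (fun k => normc (map_mx (real_complex R) (u k) i 0)) = fun k =>
    `|u k i 0|.
    by apply/funext => k; rewrite mxE /= expr0n addr0 sqrtr_sqr.
  apply => [l ls|k|k].
  - have /hA : eigenvalue (map_mx intr A : 'M[R[i]]_d.+1) l.
      by rewrite eigenvalue_root_char -cM sM root_prod_XsubC.
    by rewrite normc_def ltcR; case: (l).
  - rewrite -[in RHS]uA map_mxM; congr (_ *m _).
    by apply/matrixP => a b; rewrite !mxE rmorph_int.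
  - by rewrite -sM Cayley_Hamilton mul0mx.
apply/norm_cvg0P.
apply: (@squeeze_cvgr _ _ _ _ (fun=> 0) (fun n => \sum_i `|u n i 0|)).
- apply: nearW => n; rewrite normr_ge0/=; apply: mx_norm_le => [|i j].
    by rewrite sumr_ge0.
  by rewrite ord1 (bigD1 i)//= lerDl sumr_ge0.
- exact: cvg_cst.
- have /= :=
    @cvg_sumr R _ (index_enum _) (fun i n => `|u n i 0|) (fun=> 0) coord.
  by rewrite big1.
Qed.

End Expansive.

(** * Zeros of the Fourier transform and the cardinality bounds *)

Lemma card_le_inj (T U : Type) (L : set T) (S : set U) (f : T -> U) :
  (forall l l', L l -> L l' -> f l = f l' -> l = l') -> f @` L `<=` S ->
  (L #<= S)%card.
Proof.
move=> fI fLS; apply: card_le_trans (subset_card_le fLS).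
have /card_eqPle[] // : (f @` L #= L)%card.
by apply: inj_card_eq => l l' /set_mem Ll /set_mem Ll'; exact: fI.
Qed.

Section Invariance.
Context (R : realType) (d : nat) (A : 'M[int]_d) (B : {fset 'cV[int]_d}).
Context (mu : probability (borel R d) R).
Hypothesis hA : expansive R A.
Hypothesis hmu : invariant_measure A B mu.
Implicit Types (f : 'cV[R]_d -> R) (l x y : 'cV[R]_d).

Lemma ifs_map_continuous b : continuous (@ifs_map R d A b).
Proof.
have [C _ AC] := mulmx_norm_le (invmx (realmx R A)).
apply: (lipschitz_continuous (C := C)) => u v.
by rewrite /ifs_map -mulmxBr opprD addrACA subrr addr0 AC.
Qed.

Lemma bounded_continuous_ifs f b : bounded_continuous f ->
  bounded_continuous (f \o ifs_map A b).
Proof.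
move=> [cf [M fM]]; split; last by exists M => x; exact: fM.
by move=> x; apply: continuous_comp; [exact: ifs_map_continuous|exact: cf].
Qed.

(** Multiply by the wide tents centred at [0], which are compactly supported and
    tend to [1], and pass to the limit by dominated convergence. *)
Lemma invariant_bounded_continuous f : bounded_continuous f ->
  Rintegral mu setT f =
    #|` B|%:R^-1 * \sum_(b <- B) Rintegral mu setT (f \o ifs_map A b).
Proof.
move=> [cf [M fM]].
pose F n x := f x * tent 0 n.+1%:R x.
have cF n : continuous (F n).
  by move=> x; apply: (@continuousM _ _ f (tent 0 n.+1%:R));
    [exact: cf|exact: tent_continuous].
have FM n x : `|F n x| <= M.
  by rewrite normrM -[leRHS]mulr1 ler_pM// ger0_norm ?tent_ge0 ?tent_le1.
have Ff x : F n x @[n --> \oo] --> f x.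
  by rewrite -[X in _ --> X]mulr1; apply: cvgMr; exact: tent_cvg.
have lim1 : Rintegral mu setT (F n) @[n --> \oo] --> Rintegral mu setT f.
  exact: Rintegral_cvg cF FM cf Ff.
have lim2 :
    #|` B|%:R^-1 * \sum_(b <- B) Rintegral mu setT (F n \o ifs_map A b)
      @[n --> \oo] -->
    #|` B|%:R^-1 * \sum_(b <- B) Rintegral mu setT (f \o ifs_map A b).
  apply: cvgMr.
  apply: (@cvg_sumr R _ _ (fun b n => Rintegral mu setT (F n \o ifs_map A b)))
    => b.
  apply: (Rintegral_cvg (M := M)) => [n x|n x|x|x]; last exact: Ff.
  - by apply: continuous_comp; [exact: ifs_map_continuous|exact: cF].
  - exact: FM.
  - by apply: continuous_comp; [exact: ifs_map_continuous|exact: cf].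
suff E : (fun n => Rintegral mu setT (F n)) =
    fun n => #|` B|%:R^-1 * \sum_(b <- B) Rintegral mu setT
      (F n \o ifs_map A b).
  by rewrite -E in lim2; exact: cvg_unique lim1 lim2.
apply/funext => n; apply: hmu; first exact: cF.
apply: subclosed_compact (@tent_compact R d 0 n.+1%:R _) _ => //.
  exact: closed_closure.
by apply: closure_subset => x /=; apply: contra_neq => b0; rewrite /F b0 mulr0.
Qed.

(** The exponential of frequency [A^T l] composed with the map of [b] is the
    exponential of frequency [l] times its value at [b]. *)
Lemma fourier_ifs l :
  fourier mu ((realmx R A)^T *m l) = mask_fun B l * fourier mu l.
Proof.
have AU := expansive_unitmx hA.
have expE b x : expfun ((realmx R A)^T *m l) (ifs_map A b x) =
    expfun l x * expfun (realmx R b) l.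
  rewrite {1}/expfun dot_mulmx /ifs_map mulKVmx// -/(expfun l (x + realmx R b)).
  by rewrite expfunC expfunD !(expfunC _ l).
have [cl sl] := expfun_bounded_continuous l.
have [cAl sAl] := expfun_bounded_continuous ((realmx R A)^T *m l).
have sumE :
    \sum_(b <- B)
      cintegral mu (fun x => expfun ((realmx R A)^T *m l) (ifs_map A b x)) =
    (\sum_(b <- B) expfun (realmx R b) l) * fourier mu l.
  rewrite mulr_suml; apply: eq_bigr => b _.
  by rewrite mulrC -cintegralZ//; congr cintegral; apply/funext => x.
rewrite /mask_fun -mulrA -sumE.
have -> : (#|` B|%:R^-1 : R[i]) = (#|` B|%:R^-1 : R)%:C%C.
  by rewrite fmorphV rmorph_nat.
rewrite /fourier {1}/cintegral.
rewrite (invariant_bounded_continuous cAl) (invariant_bounded_continuous sAl).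
apply/eqP; rewrite eq_complex/=; apply/andP; split; apply/eqP.
  by rewrite ReZ (big_morph _ (@ReD R) (erefl _)).
by rewrite ImZ (big_morph _ (@ImD R) (erefl _)).
Qed.

(** Otherwise all the points of the backward orbit of [l] are zeros of the
    Fourier transform, although the orbit tends to [0]. *)
Lemma fourier_eq0 l : fourier mu l = 0 ->
  exists k y, mask_fun B y = 0 /\ l = (realmx R A)^T ^+ k *m y.
Proof.
have AU := expansive_unitmx hA.
have ATU : (realmx R A)^T \in unitmx by rewrite unitmx_tr.
move=> l0; apply: contrapT => noy.
pose u n := iter n (mulmx (invmx (realmx R A)^T)) l.
have uA n : (realmx R A)^T *m u n.+1 = u n by rewrite /u iterS mulKVmx.
have lu n : l = (realmx R A)^T ^+ n *m u n.
  elim: n => [|n IH]; first by rewrite expr0 mul1mx.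
  by rewrite [LHS]IH exprSr -uA mulmxA.
have fu n : fourier mu (u n) = 0.
  elim: n => [//|n]; rewrite -uA fourier_ifs => /eqP;
    rewrite mulf_eq0 => /orP[/eqP m0|/eqP//].
  by exfalso; apply: noy; exists n.+1, (u n.+1); split=> //; exact: lu.
have := Re_fourier_cvg mu (expansive_backward_orbit_cvg0 hA uA).
rewrite (_ : (fun n => _) = fun=> 0); last by apply/funext => n; rewrite fu.
move=> /(cvg_unique (@norm_hausdorff _ R^o) (cvg_cst (0 : R)))/eqP.
by rewrite eq_sym oner_eq0.
Qed.

Lemma realmx_trX k : (realmx R A)^T ^+ k = realmx R (A^T ^+ k).
Proof.
elim: k => [|k IH]; first by rewrite !expr0 /realmx map_mx1.
by rewrite !exprS IH [RHS]realmxM /realmx matrix.map_trmx.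
Qed.

(** The link between orthogonality and the mask: the zeros of the mask are
    lattice periodic, so they may be moved to the unit cube. *)
Lemma orthogonal_modZ_orbit l l' : inner mu (expfun l) (expfun l') = 0 ->
  orbit_zeros A B (modZ (l - l')).
Proof.
rewrite inner_expfun => /fourier_eq0[k [y [y0 E]]].
exists k, (modZ y); split.
  by split; [exact: modZ_unit_cube|rewrite mask_fun_modZ].
by rewrite E realmx_trX modZ_mulmx.
Qed.

Lemma admissible_invariant Z' : admissible A B Z' ->
  forall x, Z' (modZ x) -> Z' (modZ ((realmx R A)^T *m x)).
Proof.
move=> [_ Zc _ _ ZA] x /(periodizeP x Zc) xZ; apply/(periodizeP _ Zc).
by apply: ZA; exists x.
Qed.

Lemma orbit_sub_admissible Z' : admissible A B Z' ->
  @orbit_zeros R d A B `<=` Z'.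
Proof.
move=> aZ _ [k [x [xz ->]]]; elim: k => [|k IH].
  rewrite expr0 mul1mx modZ_id; last exact: xz.1.
  by case: aZ => _ _ + _ _; apply.
by rewrite exprS -mulmxA; exact: admissible_invariant.
Qed.

(** Fix one frequency [l0] and send [l] to [l - l0] modulo the lattice. The
    images lie in [Z'] together with [0]; a collision would put the difference
    of two frequencies in the lattice, hence [0] in [Z']. *)
Lemma card_le_admissible (Z' : set 'cV[R]_d) : admissible A B Z' ->
  at_most_orthogonal_exps mu (#|` fset_set Z'| + 1).
Proof.
move=> aZ L oL; have [fZ Zc _ Z0 _] := aZ.
have [->|/set0P[l0 Ll0]] := eqVneq L set0; first exact: card_ge0.
pose S := 0 |` Z'.
have fS : finite_set S by rewrite /S finite_setU; split.
pose f l := modZ (l - l0).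
have inj l l' : L l -> L l' -> f l = f l' -> l = l'.
  move=> Ll Ll' /modZ_eq; rewrite opprB addrA subrK => ll'.
  apply: contrapT => nll'; apply: Z0; apply: (orbit_sub_admissible aZ).
  have := orthogonal_modZ_orbit (oL _ _ Ll Ll' nll').
  suff -> : modZ (l - l') = 0 by [].
  by rewrite -(modZ_id (@unit_cube0 R d)); apply/modZ_eq; rewrite subr0.
have fLS : f @` L `<=` S.
  move=> _ [l Ll <-]; have [->|ll0] := pselect (l = l0).
    by left; rewrite /f subrr modZ_id//; exact: unit_cube0.
  by right; apply: (orbit_sub_admissible aZ); apply: orthogonal_modZ_orbit;
    exact: oL.
apply: card_le_trans (card_le_inj inj fLS) _.
have /finite_setP[n Sn] := fS.
rewrite (card_le_eql Sn) card_le_II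
  -(card_fset_set Sn) /S fset_setU1// cardfsU1.
by rewrite addnC leq_add2l leq_b1.
Qed.

Lemma card_le_ffun (L : set 'cV[R]_d) (M : nat)
    (cell : 'cV[R]_d -> {ffun 'I_d -> 'I_M}) :
  (forall l l', L l -> L l' -> cell l = cell l' -> l = l') ->
  (L #<= `I_(M ^ d))%card.
Proof.
move=> cI.
apply: (@card_le_inj _ _ _ _ (fun l => nat_of_ord (enum_rank (cell l)))).
  by move=> l l' Ll Ll' /ord_inj/enum_rank_inj; exact: cI.
move=> _ [l _ <-] /=; apply: leq_trans (ltn_ord _) _.
by rewrite card_ffun !card_ord.
Qed.

(** Cut the unit cube into cells of side [1 / M] with [M] the base of the bound.
    Two frequencies in the same cell differ, modulo the lattice, by a vector of
    Euclidean norm at most [sqrt d / M], which is less than [delta]. *)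
Lemma card_le_packing (delta : \bar R) :
  delta = set_dist (orbit_zeros A B) (@Zlattice R d) -> (0 < delta)%E ->
  at_most_orthogonal_exps mu (packing_bound d delta).
Proof.
move=> dE d0 L oL; rewrite /packing_bound.
set K := `|_|%N; rewrite addn1.
have M0 : 0 < K.+1%:R :> R by rewrite ltr0n.
have f0 (x : 'cV[R]_d) i : 0 <= Num.floor (K.+1%:R * modZ x i 0).
  have /andP[x0 _] := modZ_unit_cube x i.
  by rewrite floor_ge0 mulr_ge0// ltW.
have cell_lt (x : 'cV[R]_d) i :
    (`|Num.floor (K.+1%:R * modZ x i 0)%R| < K.+1)%N.
  have /andP[x0 x1] := modZ_unit_cube x i.
  rewrite -ltz_nat gez0_abs// -(ltr_int R).
  by apply: le_lt_trans (floor_le_tmp _) _; rewrite gtr_pMr.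
pose cell (x : 'cV[R]_d) : {ffun 'I_d -> 'I_K.+1} :=
  [ffun i => Ordinal (cell_lt x i)].
apply: (card_le_ffun (cell := cell)) => l l' Ll Ll' /ffunP cE.
apply: contrapT => ll'.
pose v := modZ l - modZ l'.
have v_le i : `|v i 0| <= K.+1%:R^-1.
  have := cE i; rewrite !ffunE => /(congr1 (@nat_of_ord _))/= fE.
  have {}fE : Num.floor (K.+1%:R * modZ l i 0) =
      Num.floor (K.+1%:R * modZ l' i 0).
    by rewrite -(gez0_abs (f0 l i)) -(gez0_abs (f0 l' i)) fE.
  have /andP[] := floor_itv (K.+1%:R * modZ l i 0).
  have /andP[] := floor_itv (K.+1%:R * modZ l' i 0).
  rewrite fE !rmorphD/= => a1 a2 b1 b2.
  rewrite -(ler_pM2l M0) mulfV ?gt_eqF// -[X in X * _]ger0_norm ?ltW// -normrM.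
  have -> : v i 0 = modZ l i 0 - modZ l' i 0 by rewrite mxE [X in _ + X]mxE.
  by rewrite mulrBr ltr_norml; apply/andP; split; lra.
have nv : euclidean_norm v <= Num.sqrt d%:R / K.+1%:R.
  have -> : Num.sqrt d%:R / K.+1%:R = Num.sqrt (d%:R * K.+1%:R^-1 ^+ 2) :> R.
    by rewrite sqrtrM// sqrtr_sqr ger0_norm// invr_ge0 ltW.
  apply: ler_wsqrtr; rewrite /dot.
  apply: le_trans (_ : \sum_(i < d) K.+1%:R^-1 ^+ 2 <= _).
    apply: ler_sum => i _; rewrite -expr2 -real_normK ?num_real//.
    by rewrite ler_pXn2r// nnegrE// invr_ge0 ltW.
  by rewrite sumr_const card_ord mulr_natl.
have dv : (delta <= (euclidean_norm v)%:E)%E.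
  rewrite dE; apply: ereal_inf_lbound.
  exists (modZ (l - l')).
    exact: orthogonal_modZ_orbit (oL _ _ Ll Ll' ll').
  exists (modZ (l - l') - v); last by rewrite opprB addrCA subrr addr0.
  rewrite (_ : _ - _ =
    (l - modZ l) - (l' - modZ l') - (l - l' - modZ (l - l'))).
    apply: ZlatticeB (modZ_Zlattice _); apply: ZlatticeB; exact: modZ_Zlattice.
  by rewrite /v; apply/matrixP => i j; rewrite !mxE; ring.
have [r r0 rE] : exists2 r : R, 0 < r & delta = r%:E.
  by move: d0 dv; case: (delta) => [r||]//= r0 _; exists r.
have KM : Num.sqrt d%:R / r < K.+1%:R.
  have E : fine ((Num.sqrt d%:R)%:E / delta)%E = Num.sqrt d%:R / r.
    by rewrite rE inver gt_eqF.
  rewrite /K E; set t := _ / r.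
  have t0 : 0 <= t by rewrite divr_ge0 ?sqrtr_ge0// ltW.
  have /andP[_] := floor_itv t; rewrite -natr1 natr_absz ger0_norm ?floor_ge0//.
  by rewrite rmorphD.
have := le_trans (_ : r <= euclidean_norm v) nv.
rewrite -lee_fin -rE => /(_ dv).
by rewrite leNgt ltr_pdivrMr// mulrC -ltr_pdivrMr// KM.
Qed.

(** Reduction modulo the lattice commutes with an integer matrix, so the orbit
    is stable by construction. *)
Lemma admissible_orbit : finite_set (@orbit_zeros R d A B) ->
  ~ @orbit_zeros R d A B 0 -> admissible A B (@orbit_zeros R d A B).
Proof.
move=> fO O0.
have Oc : @orbit_zeros R d A B `<=` @unit_cube R d.
  by move=> _ [k [x [_ ->]]]; exact: modZ_unit_cube.
split=> //.
  move=> x xz; exists 0%N, x; split=> //.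
  by rewrite expr0 mul1mx modZ_id//; exact: xz.1.
move=> _ [x /(periodizeP _ Oc)[k [y [yz E]]] <-]; apply/(periodizeP _ Oc).
exists k.+1, y; split=> //.
have EA : (realmx R A)^T = realmx R A^T by rewrite /realmx matrix.map_trmx.
by rewrite exprS -mulmxA; rewrite EA in E *; rewrite -modZ_mulmx E modZ_mulmx.
Qed.

End Invariance.

(** * The support of the invariant measure *)

(** An injective self-map of a finite set permutes it. *)
Lemma sum_injective_fset (V : zmodType) (S : {fset V}) (f : V -> V) :
  injective f ->
  (forall v, v \in S -> f v \in S) -> \sum_(v <- S) f v = \sum_(v <- S) v.
Proof.
move=> fI fS; rewrite -(big_map f xpredT id); apply: perm_big.
have u : uniq (map f S) by rewrite map_inj_uniq ?fset_uniq.
have sub : {subset map f S <= S} by move=> _ /mapP[x xS ->]; exact: fS.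
have [|_ E] := uniq_min_size u sub; first by rewrite size_map.
by apply: uniq_perm => //; exact: fset_uniq.
Qed.

Section Support.
Context (R : realType) (d : nat) (A : 'M[int]_d) (B : {fset 'cV[int]_d}).
Context (mu : probability (borel R d) R).
Hypothesis hA : expansive R A.
Hypothesis hmu : invariant_measure A B mu.
Implicit Types (f g : 'cV[R]_d -> R) (l x y : 'cV[R]_d) (r : R).

(** The topological support of [mu], tested against tents rather than against
    the measures of balls. *)
Definition measure_support : set 'cV[R]_d :=
  [set x | forall r, 0 < r -> 0 < Rintegral mu setT (tent x r)].

(** The map of [b] is Lipschitz with some constant [C], so the tent of radius
    [r] around the image dominates, along this map, the tent of radius [r / C]
    around [x]. The other maps only add nonnegative terms to the invariance
    formula. *)
Lemma measure_support_ifs b x : b \in B -> measure_support x ->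
  measure_support (ifs_map A b x).
Proof.
move=> bB xS r r0.
have [C C0 AC] := mulmx_norm_le (invmx (realmx R A)).
have rC : 0 < r / C by rewrite divr_gt0.
have bt := tent_bounded_continuous (ifs_map A b x) r0.
rewrite (invariant_bounded_continuous hmu bt) pmulr_rgt0; last first.
  rewrite invr_gt0 ltr0n cardfs_gt0; apply/fset0Pn; by exists b.
rewrite (big_rem b)//= ltr_pwDl//; last first.
  by apply: sumr_ge0 => b' _; apply: Rintegral_ge0 => y _; exact: tent_ge0.
apply: lt_le_trans (xS _ rC) _.
apply: le_Rintegral_bounded_continuous.
- exact: tent_bounded_continuous.
- exact: bounded_continuous_ifs.
move=> y; rewrite ge_max tent_ge0/= le_max; apply/orP; right.
rewrite lerD2l lerN2 invfM invrK mulrA ler_pdivrMr// mulrAC divfK ?gt_eqF//.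
by rewrite /ifs_map -mulmxBr opprD addrACA subrr addr0 mulrC AC.
Qed.

(** If every point had a tent of zero integral, then compactness would make the
    tents centred at [0] of zero integral too, although these integrals tend to
    the total mass. *)
Lemma measure_support_nonempty : measure_support !=set0.
Proof.
apply: contrapT => S0.
have null x : exists2 r, 0 < r & Rintegral mu setT (tent x r) = 0.
  apply: contrapT => nx; apply: S0; exists x => r r0.
  rewrite lt_neqAle Rintegral_ge0 ?andbT => [|y _]; last exact: tent_ge0.
  by apply/eqP => /esym E; apply: nx; exists r.
pose rad x : R := projT1 (cid2 (null x)).
have rad_gt0 x : 0 < rad x by rewrite /rad; case: cid2.
have rad_null x : Rintegral mu setT (tent x (rad x)) = 0.
  by rewrite /rad; case: cid2.
have ball_null n : Rintegral mu setT (tent 0 n.+1%:R) = 0.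
  have := @closed_ball_compact R d n.+1%:R; rewrite compact_cover => cov.
  have [|x _|D _ Dcov] := cov _ setT (fun x : 'cV[R]_d => ball x (rad x / 2)).
  - by move=> x _; exact: ball_open.
  - by exists x => [//|]; apply: ballxx; rewrite divr_gt0.
  have bt x : bounded_continuous (fun y => 2 * tent x (rad x) y).
    apply: bounded_continuousM; first exact: bounded_continuous_cst.
    exact: tent_bounded_continuous.
  apply/eqP; rewrite eq_le Rintegral_ge0 ?andbT => [|y _]; last exact: tent_ge0.
  rewrite (_ : 0 = Rintegral mu setT
    (fun y => \sum_(x <- D) 2 * tent x (rad x) y)).
    apply: le_Rintegral_bounded_continuous.
    - exact: tent_bounded_continuous.
    - exact: bounded_continuous_sum.
    move=> y; have [yn|] := ltP `|y - 0| n.+1%:R; last first.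
      move/tent_eq0 => ->//; apply: sumr_ge0 => x _.
      by rewrite mulr_ge0// tent_ge0.
    have [|x xD] := Dcov y; first by rewrite /= -[y]subr0 ltW.
    rewrite -ball_normE/= distrC => yx.
    rewrite (big_rem x)//= -[leLHS]addr0 lerD//; last first.
      by apply: sumr_ge0 => z _; rewrite mulr_ge0// tent_ge0.
    have := tent_ge_half (rad_gt0 x) yx.
    have := @tent_le1 R d 0 n.+1%:R y (ltr0Sn _ _); lra.
  rewrite Rintegral_sum//; apply/esym; apply: big1 => x _.
  rewrite RintegralZ_bounded_continuous ?rad_null ?mulr0//.
  exact: tent_bounded_continuous.
have : Rintegral mu setT (tent 0 n.+1%:R) @[n --> \oo] -->
  Rintegral mu setT (fun=> 1).
  apply: (@Rintegral_cvg R d mu (fun n => tent 0 n.+1%:R) (fun=> 1) 1).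
  - by move=> n; exact: tent_continuous.
  - by move=> n x; rewrite ger0_norm ?tent_ge0 ?tent_le1.
  - exact: cst_continuous.
  - by move=> x; exact: tent_cvg.
rewrite Rintegral_one.
under eq_fun do rewrite ball_null.
move=> /(cvg_unique (@norm_hausdorff _ R^o) (cvg_cst (0 : R)))/eqP.
by rewrite eq_sym oner_eq0.
Qed.

(** If the support were finite, then each map of the system would permute it,
    and the sum of its points would determine the digit of the map. *)
Lemma measure_support_infinite : (1 < #|` B|)%N -> infinite_set measure_support.
Proof.
move=> B1 fS; pose S := fset_set measure_support.
have [b [b' [bB b'B bb']]] : exists b b', [/\ b \in B, b' \in B & b != b'].
  have [b bB] : exists b, b \in B by apply/fset0Pn; rewrite -cardfs_gt0 ltnW.
  have [b' b'B] : exists b', b' \in (B `\ b)%fset.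
    by apply/fset0Pn; move: B1; rewrite -cardfs_gt0 (cardfsD1 b) bB.
  by exists b, b'; move: b'B; rewrite !inE eq_sym => /andP[-> ->].
have inS x : (x \in S) = (x \in measure_support) by exact: in_fset_set.
have AU := expansive_unitmx hA.
(* The affine map of [c] permutes [S]; comparing the sums over [S] and applying
   [A] isolates [c]. *)
have step c : c \in B ->
    #|` S|%:R *: realmx R c = \sum_(x <- S) (realmx R A *m x - x).
  move=> cB; have E : \sum_(x <- S) ifs_map A c x = \sum_(x <- S) x.
    apply: sum_injective_fset => [x y /(congr1 (mulmx (realmx R A)))|x].
      by rewrite /ifs_map !mulKVmx// => /addIr.
    rewrite !inS => /set_mem xS; apply: mem_set.
    exact: measure_support_ifs.
  rewrite sumrB -mulmx_sumr -[in _ *m _]E mulmx_sumr.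
  under [X in X - _]eq_bigr do rewrite /ifs_map mulKVmx//.
  rewrite big_split/= addrAC subrr add0r big_const_seq count_predT iter_addr_0.
  by rewrite scaler_nat.
have S0 : #|` S|%:R != 0 :> R.
  rewrite pnatr_eq0 cardfs_eq0; have [x xS] := measure_support_nonempty.
  apply/negP => /eqP E; have : x \in S by rewrite inS mem_set.
  by rewrite E.
move/eqP: bb'; apply.
have : realmx R b = realmx R b' by apply: (scalerI S0); rewrite !step.
by move/matrixP => E; apply/matrixP => i j; have := E i j;
  rewrite !mxE => /intr_inj.
Qed.

End Support.

(** * Finite families of exponentials do not span *)

Section InfiniteSupport.
Context (R : realType) (d : nat) (mu : probability (borel R d) R).
Hypothesis supp_inf : infinite_set (measure_support mu).

(** Take half the least distance between [n] distinct points of the support as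
    the common radius. *)
Lemma disjoint_tents n : exists (x : 'I_n -> 'cV[R]_d) (r : R),
  [/\ 0 < r, forall i, measure_support mu (x i) &
      forall i j y, i != j -> tent (x i) r y * tent (x j) r y = 0].
Proof.
have [S Smu nS] := infinite_set_fset n supp_inf.
pose x (i : 'I_n) : 'cV[R]_d := nth 0 (enum_fset S) i.
have xS i : x i \in S by apply: mem_nth; rewrite (leq_trans (ltn_ord i)).
have xI i j : x i = x j -> i = j.
  move=> /eqP; rewrite nth_uniq ?fset_uniq//; last 2 first.
    by rewrite (leq_trans (ltn_ord i)).
    by rewrite (leq_trans (ltn_ord j)).
  by move=> /eqP/ord_inj.
(* The default value 1 covers families with at most one point. *)
pose e : R := \big[Num.min/1]_(p : 'I_n * 'I_n | p.1 != p.2) `|x p.1 - x p.2|.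
have e0 : 0 < e.
  apply: lt_bigmin => // -[i j] /= ij; rewrite normr_gt0 subr_eq0.
  by apply: contra_neq ij => /xI.
have ex i j : i != j -> e <= `|x i - x j|.
  by move=> ij; apply: (bigmin_le_cond _ _ (j := (i, j))).
have r0 : 0 < e / 2 by rewrite divr_gt0.
exists x, (e / 2); split => // [i|i j y ij]; first exact/Smu/xS.
have [yi|/(tent_eq0 r0) ->] := ltP `|y - x i| (e / 2); last by rewrite mul0r.
have [yj|/(tent_eq0 r0) ->] := ltP `|y - x j| (e / 2); last by rewrite mulr0.
have := ex i j ij; rewrite leNgt => /negP; case.
rewrite (_ : x i - x j = (y - x j) - (y - x i));
  last by rewrite opprB [RHS]addrC addrA subrK.
by apply: le_lt_trans (ler_normB _ _) _; rewrite [ltRHS]splitr ltrD.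
Qed.

(** With one more tent than there are constraints, the linear system that
    expresses orthogonality has a nonzero solution. As the tents have disjoint
    supports, the square of the combination dominates the square of any one of
    its terms. *)
Lemma exists_orthogonal_function (I : finType) (g : I -> 'cV[R]_d -> R) :
  (forall k, bounded_continuous (g k)) ->
  exists psi, [/\ bounded_continuous psi,
    forall k, Rintegral mu setT (fun x => psi x * g k x) = 0 &
    0 < Rintegral mu setT (fun x => psi x ^+ 2)].
Proof.
move=> bg.
have [x [r [r0 xS tent0]]] := disjoint_tents #|I|.+1.
have bt i : bounded_continuous (tent (x i) r) by exact: tent_bounded_continuous.
pose W : 'M[R]_(#|I|.+1, #|I|) :=
  \matrix_(i, k) Rintegral mu setT (fun y => tent (x i) r y * g (enum_val k) y).
(* [W] has more rows than columns, so its left kernel is nonzero. *)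
have /rowV0Pn[a aW a0] : kermx W != 0.
  by rewrite -mxrank_eq0 mxrank_ker -lt0n subn_gt0 ltnS rank_leq_col.
move/sub_kermxP in aW.
pose psi y := \sum_i a 0 i * tent (x i) r y.
have bat i : bounded_continuous (fun y => a 0 i * tent (x i) r y).
  by apply: bounded_continuousM => //; exact: bounded_continuous_cst.
have bpsi : bounded_continuous psi by exact: bounded_continuous_sum.
exists psi; split => // [k|].
  have -> : (fun y => psi y * g k y) =
      fun y => \sum_i a 0 i * (tent (x i) r y * g k y).
    by apply/funext => y; rewrite mulr_suml; apply: eq_bigr => i _;
      rewrite mulrA.
  have btg i : bounded_continuous (fun y => tent (x i) r y * g k y) by
    exact: bounded_continuousM.
  rewrite Rintegral_sum => [|i]; last first.
    by apply: bounded_continuousM => //; exact: bounded_continuous_cst.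
  move/matrixP : aW => /(_ 0 (enum_rank k)); rewrite !mxE; apply: etrans.
  by apply: eq_bigr => i _; rewrite RintegralZ_bounded_continuous// mxE
    enum_rankK.
have [i ai] : exists i, a 0 i != 0.
  apply/existsP; rewrite -negb_forall; apply: contra a0 => /forallP h.
  by apply/eqP/rowP => j; rewrite mxE; exact/eqP.
have c0 : 0 < a 0 i ^+ 2 * (1 / 4) by rewrite mulr_gt0// exprn_even_gt0.
apply: lt_le_trans (_ : Rintegral mu setT
  (fun y => a 0 i ^+ 2 * (1 / 4) * tent (x i) (r / 2) y) <= _).
  rewrite RintegralZ_bounded_continuous;
    last by apply: tent_bounded_continuous; rewrite divr_gt0.
  by rewrite mulr_gt0//; apply: xS; rewrite divr_gt0.
have bpsi2 : bounded_continuous (fun y => psi y ^+ 2) by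
  exact: bounded_continuousM.
apply: le_Rintegral_bounded_continuous => //.
  apply: bounded_continuousM; first exact: bounded_continuous_cst.
  by apply: tent_bounded_continuous; rewrite divr_gt0.
move=> y; apply: le_trans (_ : (a 0 i * tent (x i) r y) ^+ 2 <= _).
  by rewrite exprMn -mulrA ler_wpM2l ?sqr_ge0// tent_sqr_ge.
have [->|ty] := eqVneq (tent (x i) r y) 0;
  first by rewrite mulr0 expr0n sqr_ge0.
rewrite /psi (bigD1 i)//= big1 ?addr0// => j ji.
have ij : i != j by rewrite eq_sym.
by have /eqP := tent0 i j y ij; rewrite mulf_eq0 (negbTE ty) => /eqP ->;
  rewrite mulr0.
Qed.

(** Hoelder against the constant [1], which has norm [1] since [mu] is a
    probability. *)
Lemma Rintegral_Re_le_L2norm (h : 'cV[R]_d -> R[i]) (e : R) :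
  bounded_continuous (fun x => complex.Re (h x)) ->
  bounded_continuous (fun x => complex.Im (h x)) ->
  (L2norm mu h < e%:E)%E ->
  Rintegral mu setT (fun x => `|complex.Re (h x)|) <= e.
Proof.
move=> bre bim he.
pose nh x := Normc.normc (h x).
have cn : continuous nh.
  have -> : nh = fun x =>
      Num.sqrt (complex.Re (h x) ^+ 2 + complex.Im (h x) ^+ 2).
    by apply/funext => x; rewrite /nh; case: (h x).
  move=> x; apply: (@continuous_comp _ _ _ (fun x => complex.Re (h x) ^+ 2
    + complex.Im (h x) ^+ 2) (@Num.sqrt R)).
    exact: (bounded_continuousD (bounded_continuousM bre bre)
      (bounded_continuousM bim bim)).1.
  exact: sqrt_continuous.
have := @hoelder _ (borel R d) R mu nh (cst 1) 2 2 (measurable_continuous cn)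
  (measurable_cst _) _ _ _.
rewrite Lnorm_cst1 (_ : mu _ `^ _ = 1)%E; last first.
  by rewrite (_ : mu _ = 1%E) ?poweR1r//; exact: probability_setT.
rewrite mule1 Lnorm1 => /(_ _ _ _)/le_lt_trans hn.
have babs : mu.-integrable setT (EFin \o (fun x => `|complex.Re (h x)|)).
  by apply: integrable_norm; exact: bounded_continuous_integrable.
rewrite -lee_fin /Rintegral fineK; last exact: integrable_fin_num.
apply/ltW; apply: le_lt_trans (hn _ _ _ _ he) => //; last by lra.
apply: ge0_le_integral => //.
- by case/integrableP : babs.
- apply: measurableT_comp => //; apply/measurable_EFinP.
  by apply: measurable_funM => //; exact: measurable_continuous.
- move=> x _; rewrite /= mulr1 lee_fin.
  exact: le_trans (normc_ge_Re _) (ler_norm _).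
Qed.

Lemma bounded_continuous_in_L2 (psi : 'cV[R]_d -> R) : bounded_continuous psi ->
  in_L2 mu (fun x => (psi x)%:C%C).
Proof.
move=> bpsi; split; first exact: measurable_continuous bpsi.1.
  exact: measurable_cst.
have E : (fun x => `|(Normc.normc (psi x)%:C%C)%:E| `^ 2)%E =
    EFin \o (fun x => psi x ^+ 2).
  apply/funext => x /=; rewrite expr0n addr0 sqrtr_sqr normr_id.
  by rewrite powR_mulrn// real_normK ?num_real.
rewrite /L2norm unlock; apply: poweR_lty.
rewrite (_ : integral _ _ _ = integral mu setT (EFin \o (fun x =>
  psi x ^+ 2))); last by rewrite -E.
by apply: integrable_lty => //; apply: bounded_continuous_integrable;
  exact: bounded_continuousM.
Qed.

(** Take [psi] orthogonal to the real and imaginary parts of all the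
    exponentials of [L]. For any combination [g] of them, the integral of
    [psi * Re (psi - g)] is the squared norm of [psi], whereas it is at most
    [M] times the norm of [psi - g] when [M] bounds [psi]; density would make
    that norm arbitrarily small. *)
Lemma finite_not_spectrum (L : set 'cV[R]_d) : finite_set L ->
  ~ is_spectrum mu L.
Proof.
move=> fL [_ _ dense].
pose g (p : bool * fset_set L) : 'cV[R]_d -> R := fun x =>
  if p.1 then complex.Re (expfun (val p.2) x)
  else complex.Im (expfun (val p.2) x).
have bg p : bounded_continuous (g p).
  by case: p => -[] l; [exact: (expfun_bounded_continuous _).1|exact:
    (expfun_bounded_continuous _).2].
have [psi [bpsi psig psi2]] := exists_orthogonal_function bg.
have [_ [M psiM]] := bpsi.
set c0 := Rintegral _ _ _ in psi2.
have M0 : 0 <= M by apply: le_trans (psiM 0).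
(* This accuracy gives [c0 <= M * (c0 / (M + 1)) < c0] at the end. *)
have e0 : 0 < c0 / (M + 1) by rewrite divr_gt0// ltr_wpDl.
have [s [c [sL hs]]] := dense _ (bounded_continuous_in_L2 bpsi) _ e0.
set h := (fun x => _) in hs.
have bexp (l : 'cV[R]_d) :
    bounded_continuous (fun x => complex.Re (expfun l x)) /\
    bounded_continuous (fun x => complex.Im (expfun l x)).
  exact: expfun_bounded_continuous.
have bZ (k : R) (f : 'cV[R]_d -> R) : bounded_continuous f ->
  bounded_continuous (fun x => k * f x).
  by apply: bounded_continuousM; exact: bounded_continuous_cst.
pose q l x := complex.Re (c l) * complex.Re (expfun l x) +
  - complex.Im (c l) * complex.Im (expfun l x).
pose q' l x := complex.Re (c l) * complex.Im (expfun l x) +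
  complex.Im (c l) * complex.Re (expfun l x).
have bq l : bounded_continuous (q l) by apply: bounded_continuousD; apply: bZ;
  case: (bexp l).
have bq' l : bounded_continuous (q' l) by apply: bounded_continuousD;
  apply: bZ; case: (bexp l).
have reE : (fun x => complex.Re (h x)) = fun x =>
  psi x + -1 * \sum_(l <- s) q l x.
  apply/funext => x; rewrite /h ReD mulN1r; congr (_ + _).
  rewrite -!sumrN (big_morph _ (@ReD R) (erefl _)); apply: eq_bigr => l _.
  by rewrite /q; case: (c l) => a b; case: (expfun l x) => u v /=;
    rewrite mulNr.
have imE : (fun x => complex.Im (h x)) = fun x => -1 * \sum_(l <- s) q' l x.
  apply/funext => x; rewrite /h ImD add0r mulN1r.
  rewrite -!sumrN (big_morph _ (@ImD R) (erefl _)); apply: eq_bigr => l _.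
  by rewrite /q'; case: (c l) => a b; case: (expfun l x) => u v.
have bre : bounded_continuous (fun x => complex.Re (h x)).
  by rewrite reE; apply: bounded_continuousD => //; apply: bZ;
    exact: bounded_continuous_sum.
have bim : bounded_continuous (fun x => complex.Im (h x)).
  by rewrite imE; apply: bZ; exact: bounded_continuous_sum.
have psiq l : L l -> Rintegral mu setT (fun x => psi x * q l x) = 0.
  move=> Ll; have lL : l \in fset_set L by rewrite in_fset_set// mem_set.
  have /= p1 := psig (true, FSetSub lL); have /= p2 := psig (false, FSetSub lL).
  rewrite /g/= in p1 p2.
  have -> : (fun x => psi x * q l x) = fun x =>
    complex.Re (c l) * (psi x * complex.Re (expfun l x)) +
      - complex.Im (c l) * (psi x * complex.Im (expfun l x)).
    by apply/funext => x; rewrite /q; ring.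
  have b1 := bounded_continuousM bpsi (bexp l).1;
    have b2 := bounded_continuousM bpsi (bexp l).2.
  rewrite RintegralD//; [|exact/bounded_continuous_integrable/bZ..].
  by rewrite !RintegralZ_bounded_continuous// p1 p2 !mulr0 addr0.
have I1 : Rintegral mu setT (fun x => psi x * complex.Re (h x)) = c0.
  have -> : (fun x => psi x * complex.Re (h x)) =
      fun x => psi x ^+ 2 + -1 * \sum_(l <- s) psi x * q l x.
    apply/funext => x; have -> := congr1 (@^~ x) reE.
    by rewrite mulrDr -mulr_sumr mulrCA.
  have bs : bounded_continuous (fun x => \sum_(l <- s) psi x * q l x).
    by apply: bounded_continuous_sum => l; exact: bounded_continuousM.
  rewrite RintegralD//; last 2 first.
  - exact/bounded_continuous_integrable/bounded_continuousM.
  - exact/bounded_continuous_integrable/bZ.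
  rewrite RintegralZ_bounded_continuous// Rintegral_sum => [|l];
    last exact: bounded_continuousM.
  by rewrite big_seq big1 ?mulr0 ?addr0// => l /sL; exact: psiq.
have bare : bounded_continuous (fun x => `|complex.Re (h x)|).
  split; last by case: bre => _ [N hN]; exists N => x; rewrite normr_id.
  move=> x; apply: (@continuous_comp _ _ _ (fun x => complex.Re (h x))
    (Num.norm : R -> R)); first exact: bre.1.
  exact: norm_continuous.
have := Rintegral_Re_le_L2norm bre bim hs.
have : c0 <= M * Rintegral mu setT (fun x => `|complex.Re (h x)|).
  rewrite -I1 -RintegralZ_bounded_continuous//;
    apply: le_Rintegral_bounded_continuous => //.
  - exact: bounded_continuousM.
  - by apply: bounded_continuousM => //; exact: bounded_continuous_cst.
  - by move=> x; rewrite (le_trans (ler_norm _))// normrM ler_wpM2r.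
move=> h1 h2; have := le_trans h1 (ler_wpM2l M0 h2); apply/negP.
have M1 : 0 < M + 1 by rewrite ltr_wpDl.
by rewrite -ltNge mulrA ltr_pdivrMr// mulrDr mulr1 mulrC ltrDl.
Qed.

End InfiniteSupport.

(** * Orthogonal exponentials of the invariant measure *)

Theorem theorem3p1 (R : realType) (d : nat) (A : 'M[int]_d)
    (B : {fset 'cV[int]_d}) (mu : probability (borel R d) R)
    (hA : expansive R A) (hmu : invariant_measure A B mu) :
  [/\ forall Z' : set 'cV[R]_d, admissible A B Z' ->
        at_most_orthogonal_exps mu (#|` fset_set Z'| + 1) /\
        ((1 < #|` B|)%N -> ~ spectral_measure mu),
      finite_set (@orbit_zeros R d A B) -> ~ @orbit_zeros R d A B 0 ->
        admissible A B (@orbit_zeros R d A B)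
    & forall delta : \bar R,
        delta = set_dist (orbit_zeros A B) (@Zlattice R d) ->
        (0 < delta)%E ->
        at_most_orthogonal_exps mu (packing_bound d delta)].
Proof.
split.
- move=> Z' aZ; have LZ := card_le_admissible hA hmu aZ; split=> // B1.
  move=> [L Lspec].
  have supp := measure_support_infinite hA hmu B1.
  apply: (finite_not_spectrum supp _ Lspec).
  apply/finite_set_leP; exists (#|` fset_set Z'| + 1)%N.
  by apply: LZ; case: Lspec.
- exact: admissible_orbit.
- exact: card_le_packing.
Qed.
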